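(* Let $0<|q|<1$, let $r\ge 0$ be an integer, and let $a_1,\dots,a_{r+1},b_1,\dots,b_r$ be complex numbers with $(b_j;q)_n\neq 0$ for all $j$ and $n$. Let $x,y,t\in\mathbb C$. Then: (i) if $\max\{|xt|,|yt|\}<1$, $$\sum_{n=0}^\infty \phi_n^{(\mathbf a,\mathbf b)}(x,y|q)\,\frac{t^n}{(q;q)_n}=\frac{1}{(yt;q)_\infty}\;{}_{r+1}\Phi_r\!\left[\begin{matrix}a_1,\dots,a_{r+1}\\ b_1,\dots,b_r\end{matrix};q;xt\right];$$ (ii) if $|xt|<1$, $$\sum_{n=0}^\infty (-1)^n q^{\binom n2}\,\psi_n^{(\mathbf a,\mathbf b)}(x,y|q)\,\frac{t^n}{(q;q)_n}=(yt;q)_\infty\;{}_{r+1}\Phi_r\!\left[\begin{matrix}a_1,\dots,a_{r+1}\\ b_1,\dots,b_r\end{matrix};q;xt\right].$$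
   Context: Notation: $(a;q)_0=1$, $(a;q)_n=\prod_{k=0}^{n-1}(1-aq^k)$, $(a;q)_\infty=\prod_{k=0}^\infty(1-aq^k)$, $(c_1,\dots,c_m;q)_n=\prod_i (c_i;q)_n$, and $\left[{n\atop k}\right]_q=\frac{(q;q)_n}{(q;q)_k(q;q)_{n-k}}$. Basic hypergeometric series: ${}_{r+1}\Phi_r\!\left[\begin{matrix}a_1,\dots,a_{r+1}\\ b_1,\dots,b_r\end{matrix};q;z\right]=\sum_{n\ge0}\frac{(a_1,\dots,a_{r+1};q)_n}{(b_1,\dots,b_r;q)_n}\frac{z^n}{(q;q)_n}$. With $\mathbf a=(a_1,\dots,a_{r+1})$, $\mathbf b=(b_1,\dots,b_r)$, the generalized Al-Salam-Carlitz $q$-polynomials are $$\phi_n^{(\mathbf a,\mathbf b)}(x,y|q)=\sum_{k=0}^n\left[{n\atop k}\right]_q\frac{(a_1,\dots,a_{r+1};q)_k}{(b_1,\dots,b_r;q)_k}x^ky^{n-k},$$ $$\psi_n^{(\mathbf a,\mathbf b)}(x,y|q)=\sum_{k=0}^n\left[{n\atop k}\right]_q\frac{(a_1,\dots,a_{r+1};q)_k}{(b_1,\dots,b_r;q)_k}(-1)^kq^{\binom{k+1}2-nk}x^ky^{n-k}.$$ *)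

(* Defs.v *)
From HB Require Import structures.
From mathcomp Require Import all_boot all_order all_algebra.
From mathcomp Require Import complex.
From mathcomp Require Import all_classical all_reals all_analysis.

Set Implicit Arguments.
Unset Strict Implicit.
Unset Printing Implicit Defensive.

Import Order.TTheory GRing.Theory Num.Theory.
Import numFieldNormedType.Exports.

Local Open Scope classical_set_scope.
Local Open Scope ring_scope.

(* The field of complex numbers over R : realType.
   R[i] has no topology declared on it in the libraries; bundling it as a
   numClosedFieldType makes the generic norm, topology and normed-module
   instances of numFieldNormedType apply.  The norm `|z| is the modulus, seen as
   an element of R[i]; the order of R[i] restricts to the usual one on reals. *)
Definition Cplx (R : realType) : numClosedFieldType := R[i].

Section QSeries.
Variable R : realType.
Local Notation C := (Cplx R).
Implicit Types (q z x y : C) (n k r : nat).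

Definition qpoch z q n : C := \prod_(k < n) (1 - z * q ^+ k).

(* [limn] has an unspecified value on divergent sequences; the partial products
   converge whenever `|q| < 1. *)
Definition qpoch_inf z q : C := limn (qpoch z q).

Definition qbinom q n k : C := qpoch q q n / (qpoch q q k * qpoch q q (n - k)).

Definition qpoch_ratio r (a : 'I_r.+1 -> C) (b : 'I_r -> C) q k : C :=
  (\prod_(i < r.+1) qpoch (a i) q k) / (\prod_(j < r) qpoch (b j) q k).

Definition qhyper_term r (a : 'I_r.+1 -> C) (b : 'I_r -> C) q z n : C :=
  qpoch_ratio a b q n * (z ^+ n / qpoch q q n).

(* As for [qpoch_inf], only meaningful when the series converges. *)
Definition qhyper r (a : 'I_r.+1 -> C) (b : 'I_r -> C) q z : C :=
  limn (series (qhyper_term a b q z)).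

Definition ASC_phi r (a : 'I_r.+1 -> C) (b : 'I_r -> C) n x y q : C :=
  \sum_(k < n.+1) qbinom q n k * qpoch_ratio a b q k * x ^+ k * y ^+ (n - k).

(* The exponent of q may be negative, hence is taken in int. *)
Definition ASC_psi r (a : 'I_r.+1 -> C) (b : 'I_r -> C) n x y q : C :=
  \sum_(k < n.+1) qbinom q n k * qpoch_ratio a b q k *
    ((-1) ^+ k * q ^ ('C(k.+1, 2)%:Z - (n * k)%N%:Z)) * x ^+ k * y ^+ (n - k).

End QSeries.

(* Main.v *)
Require Import Defs.
From HB Require Import structures.
From mathcomp Require Import all_boot all_order all_algebra.
From mathcomp Require Import complex ring lra zify.
From mathcomp Require Import all_classical all_reals all_analysis.

Set Implicit Arguments.
Unset Strict Implicit.
Unset Printing Implicit Defensive.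

Import Order.TTheory GRing.Theory Num.Theory.
Import numFieldNormedType.Exports.

Local Open Scope classical_set_scope.
Local Open Scope ring_scope.

(** Both series are Cauchy products.  Writing n = k + m, the q-binomial
    coefficient splits as (q;q)_n / ((q;q)_k (q;q)_m), so that the n-th term of
    (i) is the sum over k + m = n of
      W_k (xt)^k / (q;q)_k  times  (yt)^m / (q;q)_m,
    where W_k is the ratio of shifted factorials in the a_i and b_j.  In (ii)
    the powers of q collapse, because
      C(k+m,2) + C(k+1,2) - (k+m) k = C(m,2),
    and the second factor becomes (-1)^m q^C(m,2) (yt)^m / (q;q)_m.  The first
    factor always sums to the hypergeometric series, and the second one sums
    to 1/(yt;q)_oo in (i) and to (yt;q)_oo in (ii) by Euler's two identities.

    The two Euler identities are specialisations, be = 0 and al = 0, of one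
    homogeneous q-binomial theorem.  Let F(al, be) be the sum of the
      prod_(k<n) (al - be q^k) / (1 - q^(k+1)),   for |al| < 1.
    The recursion satisfied by these terms gives
      (1 - al) F(al, be) = (1 - be) F(al q, be q)    (qbin_sum_step),
    hence (al;q)_n F(al, be) = (be;q)_n F(al q^n, be q^n), and the last factor
    tends to the constant term 1 (qbin_sum_dilate).  Convergence of the
    products (z;q)_n is a by-product of this relation, as is the
    nonvanishing of their limit for |z| < 1.

    Analytically everything rests on one kind of estimate: every series here
    satisfies a first-order recursion whose ratio tends to a number of modulus
    less than 1, so its terms are dominated by a geometric sequence
    (ratio_test).  That alone gives convergence (geom_bounded_cvg), the Cauchy
    product (cauchy_product) and the limit of q-dilated sums
    (cvg_dilated_series). *)

(** * Geometrically dominated series of complex numbers *)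

Lemma limn_eq (K : numFieldType) (u : nat -> K) (l : K) :
  u @ \oo --> l -> limn u = l.
Proof. by apply: cvg_lim; exact: norm_hausdorff. Qed.

Lemma cvg_succ (K : numFieldType) (u : nat -> K) (l : K) :
  u @ \oo --> l -> (fun n => u n.+1) @ \oo --> l.
Proof. by rewrite -(cvg_shiftS u). Qed.

Section ComplexSequences.
Variable R : realType.
Local Notation C := (Cplx R).
Local Notation ofR := (real_complex R : R -> C).
Implicit Types (u v : nat -> C).

(** Positive elements of the complex field are real, so every epsilon of its
    topology comes from the base field. *)
Lemma gt0_ofR (e : C) : 0 < e -> exists2 d : R, 0 < d & e = ofR d.
Proof.
move=> e0; have ed : ofR (complex.Re e) = e by rewrite RRe_real // gtr0_real.
by exists (complex.Re e) => //; rewrite -ltcR ed.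
Qed.

Lemma norm_ofR (x : R) : `|ofR x| = ofR `|x|.
Proof. by rewrite normc_def /= expr0n addr0 sqrtr_sqr. Qed.

(** The norm of a complex number is itself a complex number; this is its value
    in the base field, where the order is total and geometric limits live. *)
Definition modulus (z : C) : R := complex.Re `|z|.

Lemma ofR_modulus (z : C) : ofR (modulus z) = `|z|.
Proof. exact: RRe_real (normr_real z). Qed.

Lemma modulus_ge0 (z : C) : 0 <= modulus z.
Proof. by rewrite -lecR ofR_modulus normr_ge0. Qed.

Lemma modulus_lt1 (z : C) : `|z| < 1 -> modulus z < 1.
Proof. by move=> z1; rewrite -ltcR ofR_modulus. Qed.

Lemma cvg_ofR (w : nat -> R) (l : R) :
  w @ \oo --> l -> (fun n => ofR (w n)) @ \oo --> ofR l.
Proof.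
move=> wl; apply/cvgrPdist_lt => e /gt0_ofR[d d0 ->].
move/cvgrPdist_lt: wl => /(_ d d0); apply: filterS => n.
by rewrite -rmorphB norm_ofR ltcR.
Qed.

Lemma cvg_dominated u l (w : nat -> R) :
  (forall n, `|u n - l| <= ofR (w n)) -> w @ \oo --> (0 : R) ->
  u @ \oo --> l.
Proof.
move=> uw w0; apply/cvgrPdist_lt => e /gt0_ofR[d d0 ->].
move/cvgrPdist_lt: w0 => /(_ d d0); apply: filterS => n.
rewrite sub0r normrN => wd; rewrite distrC.
by apply: le_lt_trans (uw n) _; rewrite ltcR (le_lt_trans _ wd) // ler_norm.
Qed.

Lemma cvg_exprC (z : C) : `|z| < 1 -> (fun n => z ^+ n) @ \oo --> (0 : C).
Proof.
move=> z1; apply: (@cvg_dominated _ _ (fun n => modulus z ^+ n)).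
  by move=> n; rewrite subr0 normrX rmorphXn /= ofR_modulus.
by apply: cvg_expr; rewrite ger0_norm ?modulus_ge0// modulus_lt1.
Qed.

(** The order on complex numbers is partial, but both sides of a comparison of
    norms are real, so a strict reverse inequality would be contradicted by a
    close enough term of the sequence. *)
Lemma norm_lim_le u (l c : C) (B : R) :
  u @ \oo --> l -> (\forall n \near \oo, `|u n - c| <= ofR B) ->
  `|l - c| <= ofR B.
Proof.
move=> ul uB; rewrite real_leNgt ?normr_real//; last first.
  by apply/complex_realP; exists B.
apply/negP => Bl; have e0 : 0 < `|l - c| - ofR B by rewrite subr_gt0.
move/cvgrPdist_lt: ul => /(_ _ e0) ul.
have [N _ /(_ N (leqnn N))[h1 h2]] := filterI ul uB.
have := ler_normD (l - u N) (u N - c); rewrite addrA subrK.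
apply/negP; rewrite -real_ltNge ?realD ?normr_real//.
by rewrite -(subrK (ofR B) `|l - c|) ltr_leD.
Qed.

Definition geom_bounded u :=
  exists M s : R, [/\ 0 <= M, 0 <= s, s < 1 &
    forall n, `|u n| <= ofR (M * s ^+ n)].

Lemma geom_sum_le (s : R) m n : 0 <= s -> s < 1 ->
  \sum_(m <= i < n) s ^+ i <= s ^+ m / (1 - s).
Proof.
move=> s0 s1; have s1' : 0 < 1 - s by rewrite subr_gt0.
have [mn|nm] := leqP m n; last first.
  by rewrite big_geq ?(ltnW nm)// divr_ge0 ?exprn_ge0// ltW.
rewrite ler_pdivlMr// mulr_suml.
rewrite (telescope_sumr_eq (fun i => - s ^+ i))// => [|i _]; last first.
  by rewrite exprS; ring.
by rewrite opprK addrC gerBl exprn_ge0.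
Qed.

(** Completeness is only needed over the base field: the real and imaginary
    parts are each dominated by the same convergent geometric series. *)
Lemma geom_bounded_cvg u : geom_bounded u -> cvgn (series u).
Proof.
move=> [M [s [M0 s0 s1 uM]]].
have real_cvg (w : nat -> R) :
    (forall n, ofR `|w n| <= `|u n|) -> cvgn (series w).
  move=> wu; apply: normed_cvg.
  apply: (@series_le_cvg _ _ (geometric M s)) => [n|n|n|] /=.
  - exact: normr_ge0.
  - by rewrite mulr_ge0 ?exprn_ge0.
  - by rewrite -lecR (le_trans (wu n)).
  - by apply: is_cvg_geometric_series; rewrite ger0_norm.
have /real_cvg cRe : forall n, ofR `|complex.Re (u n)| <= `|u n|.
  by move=> n; exact: normc_ge_Re.
have /real_cvg cIm : forall n, ofR `|complex.Im (u n)| <= `|u n|.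
  move=> n; have := normc_ge_Re (- (u n * 'i%C)).
  rewrite normrN normrM.
  have -> : `|'i%C : R[i]| = 1 by rewrite complexiE normCi.
  by rewrite mulr1 raddfN /= ReiNIm opprK.
have -> : series u = (fun n => ofR (series (fun k => complex.Re (u k)) n)
            + 'i%C * ofR (series (fun k => complex.Im (u k)) n)) :> (nat -> C).
  apply/funext => n; rewrite /series /= !rmorph_sum mulr_sumr -big_split /=.
  by apply: eq_bigr => k _; exact: complexE.
apply: is_cvgD.
  by apply: cvgP; apply: cvg_ofR; exact: cRe.
by apply: is_cvgMl_tmp; apply: cvgP; apply: cvg_ofR; exact: cIm.
Qed.

(** A ratio s strictly between |l| and 1 works from some rank N on; the constant
    M is chosen large enough to cover the finitely many earlier terms. *)
Lemma ratio_test u (g : nat -> C) (l : C) :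
  (forall n, u n.+1 = g n * u n) -> g @ \oo --> l -> `|l| < 1 ->
  geom_bounded u.
Proof.
move=> ug gl l1; have l1' := modulus_lt1 l1; have l0 := modulus_ge0 l.
pose s := (1 + modulus l) / 2.
have s0 : 0 < s by rewrite /s; lra.
have s1 : s < 1 by rewrite /s; lra.
have e0 : 0 < ofR (s - modulus l) by rewrite ltcR /s; lra.
move/cvgrPdist_lt: gl => /(_ _ e0)[N _ gN].
have {}gN n : (N <= n)%N -> `|g n| <= ofR s.
  move=> /gN /= /ltW h; rewrite -(subrK l (g n)) (le_trans (ler_normD _ _))//.
  by rewrite -lerBrDr distrC (le_trans h)// rmorphB/= ofR_modulus.
(* A sum rather than a maximum: it dominates each of its nonnegative terms. *)
pose M := \sum_(i < N.+1) modulus (u i) / s ^+ i.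
have t0 i : 0 <= modulus (u i) / s ^+ i.
  by rewrite divr_ge0 ?modulus_ge0// exprn_ge0// ltW.
have M0 : 0 <= M by exact: sumr_ge0.
exists M, s; split=> //; first exact: ltW.
have small n : (n <= N)%N -> `|u n| <= ofR (M * s ^+ n).
  move=> nN; rewrite -ofR_modulus lecR -ler_pdivrMr ?exprn_gt0//.
  by rewrite /M (bigD1 (Ordinal (nN : (n < N.+1)%N)))//= lerDl sumr_ge0.
elim=> [|n IH]; first exact: small.
have [/small//|Nn] := leqP n.+1 N.
rewrite ug normrM exprS mulrCA rmorphM.
by apply: ler_pM => //; exact: gN.
Qed.

Lemma sum_triangle (V : nmodType) (F : nat -> nat -> V) N :
  \sum_(0 <= n < N) \sum_(k < n.+1) F k (n - k)%N =
  \sum_(0 <= k < N) \sum_(0 <= j < N - k) F k j.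
Proof.
elim: N => [|N IH]; first by rewrite !big_geq.
rewrite big_nat_recr//= IH [RHS]big_nat_recr//= subSnn big_nat1.
rewrite big_ord_recr/= subnn addrA; congr (_ + _).
rewrite -(big_mkord xpredT (fun k => F k (N - k)%N)) -big_split/=.
by apply: eq_big_nat => k /andP[_ kN]; rewrite subSn 1?ltnW// big_nat_recr.
Qed.

(** The product of the N-th partial sums and the N-th partial sum of the
    Cauchy product differ by the terms u_k v_j with k, j < N <= k + j.  For
    each k the sum over j is part of the tail of the series of v from N - k on. *)
Lemma cauchy_product u v : geom_bounded u -> geom_bounded v ->
  series (fun n => \sum_(k < n.+1) u k * v (n - k)%N) @ \oo -->
  (limn (series u) * limn (series v) : C).
Proof.
move=> gu gv; have cu := geom_bounded_cvg gu; have cv := geom_bounded_cvg gv.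
have [M [s [M0 s0 s1 uM]]] := gu; have [M' [s' [M'0 s'0 s'1 vM]]] := gv.
(* Majorising v by t^n with t > s, instead of by s'^n, makes the bound
   s^k t^(N-k) = t^N (s/t)^k of the k-th tail summable in k. *)
have [t [st s't t0 t1]] : exists t, [/\ s < t, s' < t, 0 < t & t < 1].
  exists ((1 + Num.max s s') / 2).
  by rewrite /Num.max; case: ifPn => h; split; lra.
have cuv : (fun N => series u N * series v N : C) @ \oo -->
    (limn (series u) * limn (series v) : C).
  exact: (@cvgM C _ _ _ _ _ _ _ cu cv).
rewrite -[X in _ --> X](add0r (limn (series u) * limn (series v) : C)).
pose w n := \sum_(k < n.+1) u k * v (n - k)%N.
have -> : series w = (fun N => (series w N - series u N * series v N) +
    series u N * series v N) :> (nat -> C).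
  by apply/funext => N; rewrite subrK.
apply: (@cvgD C C) cuv.
pose B := M * M' / (1 - t) / (1 - s / t).
have st1 : s / t < 1 by rewrite ltr_pdivrMr// mul1r.
have st0 : 0 <= s / t by rewrite divr_ge0// ltW.
apply: (@cvg_dominated _ _ (fun n => B * t ^+ n)); last first.
  rewrite -(mulr0 B); apply: cvgMl_tmp; apply: cvg_expr.
  by rewrite ger0_norm// ltW.
move=> N; rewrite subr0.
have -> : series w N - series u N * series v N =
          - \sum_(0 <= k < N) u k * \sum_(N - k <= j < N) v j.
  rewrite /series/= /w (sum_triangle (fun k j => u k * v j)).
  rewrite mulr_suml -sumrB -sumrN; apply: eq_big_nat => k /andP[_ kN].
  rewrite -mulr_sumr -mulrBr (@big_cat_nat _ _ _ (N - k)%N 0 N)//= ?leq_subr//.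
  by rewrite opprD addNKr mulrN.
rewrite normrN (le_trans (ler_norm_sum _ _ _))//.
have tail k : (k <= N)%N ->
    `|u k * \sum_(N - k <= j < N) v j| <=
    ofR (M * M' / (1 - t) * t ^+ N * (s / t) ^+ k).
  move=> kN; have -> : M * M' / (1 - t) * t ^+ N * (s / t) ^+ k =
      (M * s ^+ k) * (M' * (t ^+ (N - k) / (1 - t))).
    rewrite expr_div_n -{1}(subnK kN) exprD; field.
    by rewrite expf_neq0 gt_eqF ?subr_gt0.
  rewrite normrM rmorphM; apply: ler_pM => //.
  apply: (le_trans (ler_norm_sum _ _ _)).
  have : \sum_(N - k <= j < N) `|v j| <=
         \sum_(N - k <= j < N) ofR (M' * t ^+ j).
    apply: ler_sum => j _; apply: (le_trans (vM j)).
    by rewrite lecR ler_wpM2l// lerXn2r ?nnegrE// ltW.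
  move=> /le_trans; apply; rewrite -rmorph_sum lecR -mulr_sumr ler_wpM2l//.
  by apply: geom_sum_le => //; exact: ltW.
apply: (@le_trans _ _ (\sum_(0 <= k < N)
    ofR (M * M' / (1 - t) * t ^+ N * (s / t) ^+ k))).
  by apply: ler_sum_nat => k /andP[_ kN]; rewrite tail// ltnW.
rewrite -rmorph_sum lecR -mulr_sumr /B [leRHS]mulrAC ler_wpM2l//.
  by rewrite !mulr_ge0// ?invr_ge0 ?subr_ge0 ?exprn_ge0// ltW.
by rewrite (le_trans (geom_sum_le _ _ _ _))// expr0 mul1r.
Qed.

(** All terms but the constant one acquire at least one factor q^n, so the
    distance to u_0 is at most |q|^n times the sum of the |u_m|. *)
Lemma cvg_dilated_series u (q : C) : `|q| < 1 -> geom_bounded u ->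
  (fun n => limn (series (fun m => (q ^+ n) ^+ m * u m)) : C) @ \oo --> u 0%N.
Proof.
move=> q1 [M [s [M0 s0 s1 uM]]].
have q0 := modulus_ge0 q; have q1' := modulus_lt1 q1.
apply: (@cvg_dominated _ _ (fun n => M / (1 - s) * modulus q ^+ n)); last first.
  rewrite -(mulr0 (M / (1 - s))); apply: cvgMl_tmp; apply: cvg_expr.
  by rewrite ger0_norm.
move=> n.
have qn1 : modulus q ^+ n <= 1 by rewrite exprn_ile1// ltW.
have qn0 : 0 <= modulus q ^+ n by rewrite exprn_ge0.
have dM m : `|(q ^+ n) ^+ m * u m| <= ofR (M * s ^+ m).
  rewrite normrM (le_trans _ (uM m))// ler_piMl// !normrX -ofR_modulus.
  by rewrite -!rmorphXn -[1](rmorph1 (real_complex R)) lecR exprn_ile1.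
apply: (@norm_lim_le (series (fun m => (q ^+ n) ^+ m * u m))).
  by apply: geom_bounded_cvg; exists M, s.
exists 1%N => // N /= N0; rewrite /series/= big_ltn// expr0 mul1r.
rewrite addrAC subrr add0r.
apply: (le_trans (ler_norm_sum _ _ _)).
apply: (@le_trans _ _ (\sum_(1 <= m < N) ofR (M * modulus q ^+ n * s ^+ m))).
  apply: ler_sum_nat => m /andP[m0 _]; rewrite mulrAC mulrC normrM rmorphM.
  apply: ler_pM => //; rewrite normrX normrX -ofR_modulus -!rmorphXn lecR.
  by rewrite -(prednK m0) exprS ler_piMr// exprn_ile1.
rewrite -rmorph_sum lecR -mulr_sumr [leRHS]mulrAC ler_wpM2l ?mulr_ge0//.
rewrite (le_trans (geom_sum_le _ _ _ _))// ler_piMl//.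
  by rewrite invr_ge0 subr_ge0 ltW.
by rewrite expr1 ltW.
Qed.
End ComplexSequences.

(** * The homogeneous q-binomial theorem and Euler's identities *)

Section QBinomial.
Variable R : realType.
Local Notation C := (Cplx R).
Implicit Types (q al be z : C).

Lemma qpochS q z n : qpoch z q n.+1 = qpoch z q n * (1 - z * q ^+ n).
Proof. exact: big_ord_recr. Qed.

Lemma subr1_expr_neq0 q n : `|q| < 1 -> 1 - q ^+ n.+1 != 0.
Proof.
move=> q1; rewrite subr_eq0; apply/eqP => /(congr1 Num.norm).
by rewrite normr1 normrX => /esym/eqP; rewrite lt_eqF// exprn_ilt1.
Qed.

Lemma qpoch_qq_neq0 q n : `|q| < 1 -> qpoch q q n != 0.
Proof.
move=> q1; apply/prodf_neq0 => k _.
by rewrite -exprS subr1_expr_neq0.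
Qed.

Lemma cvg_subrM_expr q (c d : C) : `|q| < 1 ->
  (fun n => c - d * q ^+ n) @ \oo --> c.
Proof.
move=> q1; rewrite -[X in _ --> X]subr0 -(mulr0 d).
apply: (@cvgB C C); first exact: cvg_cst.
by apply: (@cvgMl_tmp C); exact: cvg_exprC.
Qed.

(** The term (c;q)_n z^n / (q;q)_n of the q-binomial series with al = z and
    be = c z; keeping al and be independent also allows al = 0, the limiting
    case in which c tends to infinity, which is Euler's second series. *)
Definition qbin_term q al be n : C :=
  \prod_(k < n) ((al - be * q ^+ k) / (1 - q ^+ k.+1)).

Lemma qbin_termS q al be n : qbin_term q al be n.+1 =
  (al - be * q ^+ n) / (1 - q ^+ n.+1) * qbin_term q al be n.
Proof. by rewrite [RHS]mulrC; exact: big_ord_recr. Qed.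

Lemma qbin_term_scale q al be c n :
  qbin_term q (al * c) (be * c) n = c ^+ n * qbin_term q al be n.
Proof.
elim: n => [|n IH]; first by rewrite /qbin_term !big_ord0 mulr1.
by rewrite !qbin_termS IH (exprS c); ring.
Qed.

Lemma qbin_term_bounded q al be : `|q| < 1 -> `|al| < 1 ->
  geom_bounded (qbin_term q al be).
Proof.
move=> q1 al1; apply: (ratio_test (qbin_termS q al be)) al1.
rewrite -[X in _ --> X]mulr1 -[X in _ * X]invr1.
apply: (@cvgM C); first exact: cvg_subrM_expr.
apply: (@cvgV C); first exact: oner_neq0.
under eq_fun do rewrite exprS.
exact: cvg_subrM_expr.
Qed.

Definition qbin_sum q al be : C := limn (series (qbin_term q al be)).

Lemma qbin_sum_cvg q al be : `|q| < 1 -> `|al| < 1 ->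
  series (qbin_term q al be) @ \oo --> qbin_sum q al be.
Proof. by move=> q1 al1; apply: geom_bounded_cvg; exact: qbin_term_bounded. Qed.

Lemma norm_mul_lt1 q al : `|q| < 1 -> `|al| < 1 -> `|al * q| < 1.
Proof. by move=> q1 al1; rewrite normrM mulr_ilt1. Qed.

(** Dilating both parameters by q multiplies the m-th term by q^m, so the
    difference of the two series has terms u_m (1 - q^m), which the recursion
    turns into al u_(m-1) - be q^(m-1) u_(m-1). *)
Lemma qbin_sum_step q al be : `|q| < 1 -> `|al| < 1 ->
  qbin_sum q al be * (1 - al) = (1 - be) * qbin_sum q (al * q) (be * q).
Proof.
move=> q1 al1; set S := series (qbin_term q al be).
set T := series (qbin_term q (al * q) (be * q)).
have cS : S @ \oo --> qbin_sum q al be by exact: qbin_sum_cvg.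
have cT : T @ \oo --> qbin_sum q (al * q) (be * q).
  by apply: qbin_sum_cvg => //; exact: norm_mul_lt1.
have partial N : S N.+1 - T N.+1 = al * S N - be * T N.
  rewrite /S /T /series/= !mulr_sumr -!sumrB big_nat_recl//=.
  rewrite {1 2}/qbin_term !big_ord0 subrr add0r.
  apply: eq_bigr => m _; rewrite !qbin_term_scale qbin_termS exprS.
  have := subr1_expr_neq0 m q1; rewrite exprS => h.
  by field.
have c1 : (fun N => S N.+1 - T N.+1) @ \oo -->
    (qbin_sum q al be - qbin_sum q (al * q) (be * q) : C).
  have cS' : (fun N => S N.+1) @ \oo --> qbin_sum q al be.
    exact: (cvg_succ cS).
  have cT' : (fun N => T N.+1) @ \oo --> qbin_sum q (al * q) (be * q).
    exact: (cvg_succ cT).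
  exact: (@cvgB C C _ _ _ _ _ _ _ cS' cT').
have c2 : (fun N => al * S N - be * T N) @ \oo -->
    (al * qbin_sum q al be - be * qbin_sum q (al * q) (be * q) : C).
  exact: (@cvgB C C _ _ _ _ _ _ _ (@cvgMl_tmp C _ _ _ _ al _ cS)
    (@cvgMl_tmp C _ _ _ _ be _ cT)).
have := @cvg_unique C (@norm_hausdorff C C) _ _ _ _ c1.
under eq_fun do rewrite partial.
move=> /(_ _ _ c2) /= e; rewrite mulrBr mulrBl mulr1 mul1r [_ * al]mulrC.
apply: subr0_eq; set F := qbin_sum q al be in e *.
set G := qbin_sum q _ _ in e *.
by rewrite -(subrr (al * F - be * G)) -{1}e; ring.
Qed.

Lemma qbin_sum_iter q al be n : `|q| < 1 -> `|al| < 1 ->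
  qbin_sum q al be * qpoch al q n =
  qpoch be q n * qbin_sum q (al * q ^+ n) (be * q ^+ n).
Proof.
move=> q1 al1; elim: n => [|n IH].
  by rewrite /qpoch !big_ord0 !expr0 !mulr1 mul1r.
rewrite !qpochS mulrA IH -mulrA qbin_sum_step//; last first.
  by rewrite normrM normrX (le_lt_trans _ al1)// ler_piMr// exprn_ile1// ltW.
by rewrite -!mulrA exprSr.
Qed.

Lemma qbin_sum_dilate q al be : `|q| < 1 -> `|al| < 1 ->
  (fun n => qbin_sum q (al * q ^+ n) (be * q ^+ n)) @ \oo --> (1 : C).
Proof.
move=> q1 al1; have := cvg_dilated_series q1 (qbin_term_bounded be q1 al1).
rewrite {2}/qbin_term big_ord0; apply: cvg_trans.
rewrite (_ : (fun n => _) =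
             (fun n => qbin_sum q (al * q ^+ n) (be * q ^+ n)))//.
apply/funext => n; rewrite /qbin_sum; congr (limn (series _)).
by apply/funext => m; rewrite qbin_term_scale.
Qed.

Lemma qbin_term_euler1 q z n : qbin_term q z 0 n = z ^+ n / qpoch q q n.
Proof.
elim: n => [|n IH]; first by rewrite /qbin_term /qpoch !big_ord0 divr1.
by rewrite qbin_termS IH qpochS !exprS invfM; ring.
Qed.

Lemma qbin_term_euler2 q z n :
  qbin_term q 0 z n = (-1) ^+ n * q ^+ 'C(n, 2) * (z ^+ n / qpoch q q n).
Proof.
elim: n => [|n IH]; first by rewrite /qbin_term /qpoch !big_ord0 divr1 !mulr1.
by rewrite qbin_termS IH qpochS binS bin1 exprD !exprS invfM; ring.
Qed.

(** For al = 0 the iterated relation reads F(0, z) = (z;q)_n F(0, z q^n), and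
    the last factor, tending to 1, can be divided out for large n.  This is both
    the convergence of the infinite product for every z and Euler's expansion
    of it. *)
Lemma cvg_qpoch q z : `|q| < 1 -> qpoch z q @ \oo --> qbin_sum q 0 z.
Proof.
move=> q1; have z1 : `|0 : C| < 1 by rewrite normr0.
have cF := qbin_sum_dilate z q1 z1.
rewrite -[X in _ --> X]divr1.
have : (fun n => qbin_sum q 0 z / qbin_sum q (0 * q ^+ n) (z * q ^+ n)) @ \oo
    --> (qbin_sum q 0 z / 1 : C).
  by apply: (@cvgMl_tmp C); apply: (@cvgV C) => //; exact: oner_neq0.
apply: cvg_trans; apply: near_eq_cvg.
have lt01 : (0 : C) < 1 by [].
move/cvgrPdist_lt: cF => /(_ 1 lt01); apply: filterS => n.
move=> Fn; have := qbin_sum_iter z n q1 z1.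
have -> : qpoch 0 q n = 1 :> C by apply: big1 => k _; rewrite mul0r subr0.
rewrite mulr1 => ->; rewrite mulfK//; apply: contraTneq Fn => ->.
by rewrite subr0 normr1 ltxx.
Qed.

Lemma qpoch_infE q z : `|q| < 1 -> qpoch_inf z q = qbin_sum q 0 z.
Proof. by move=> q1; apply: limn_eq; exact: cvg_qpoch. Qed.

(** For be = 0 the iterated relation reads F(z, 0) (z;q)_n = F(z q^n, 0).  As a
    product equal to 1, the identity also shows that (z;q)_oo is not 0. *)
Lemma qpoch_inf_euler1 q z : `|q| < 1 -> `|z| < 1 ->
  qbin_sum q z 0 * qpoch_inf z q = 1.
Proof.
move=> q1 z1; rewrite qpoch_infE//.
have c1 : (fun n => qbin_sum q z 0 * qpoch z q n) @ \oo -->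
    (qbin_sum q z 0 * qbin_sum q 0 z : C).
  by apply: (@cvgMl_tmp C); exact: cvg_qpoch.
have c2 := qbin_sum_dilate 0 q1 z1.
suff e : (fun n => qbin_sum q z 0 * qpoch z q n) =
         (fun n => qbin_sum q (z * q ^+ n) (0 * q ^+ n)).
  by rewrite -(limn_eq c1) e (limn_eq c2).
apply/funext => n; rewrite qbin_sum_iter//.
by rewrite [qpoch 0 q n]big1 ?mul1r// => k _; rewrite mul0r subr0.
Qed.
End QBinomial.

(** * The generating functions as Cauchy products *)

Section GeneratingFunctions.
Variable R : realType.
Local Notation C := (Cplx R).
Variables (q : C) (r : nat) (a : 'I_r.+1 -> C) (b : 'I_r -> C).
Hypothesis q1 : `|q| < 1.

Lemma qpoch_ratioS n : qpoch_ratio a b q n.+1 =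
  qpoch_ratio a b q n * ((\prod_(i < r.+1) (1 - a i * q ^+ n)) /
                         (\prod_(j < r) (1 - b j * q ^+ n))).
Proof.
rewrite /qpoch_ratio.
under eq_bigr do rewrite qpochS.
under [X in _ / X]eq_bigr do rewrite qpochS.
by rewrite !big_split/= invfM; ring.
Qed.

Lemma cvg_prod_subrM_expr m (c : 'I_m -> C) :
  (fun n => \prod_(i < m) (1 - c i * q ^+ n)) @ \oo --> (1 : C).
Proof.
elim: m c => [|m IH] c.
  by under eq_fun do rewrite big_ord0; exact: cvg_cst.
rewrite -[X in _ --> X]mulr1; under eq_fun do rewrite big_ord_recr.
apply: (@cvgM C); first exact: IH.
exact: cvg_subrM_expr.
Qed.

Lemma qhyper_term_bounded (z : C) : `|z| < 1 ->
  geom_bounded (qhyper_term a b q z).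
Proof.
move=> z1; apply: (@ratio_test _ _ (fun n =>
  (\prod_(i < r.+1) (1 - a i * q ^+ n)) / (\prod_(j < r) (1 - b j * q ^+ n)) *
  (z / (1 - q * q ^+ n))) z) z1.
  by move=> n; rewrite /qhyper_term qpoch_ratioS qpochS exprS invfM; ring.
rewrite -[X in _ --> X]mul1r; apply: (@cvgM C).
  rewrite -[X in _ --> X]divr1; apply: (@cvgM C).
    exact: cvg_prod_subrM_expr.
  by apply: (@cvgV C); [exact: oner_neq0|exact: cvg_prod_subrM_expr].
rewrite -[X in _ --> X]divr1; apply: (@cvgMl_tmp C).
by apply: (@cvgV C); [exact: oner_neq0|exact: cvg_subrM_expr].
Qed.

Lemma ASC_phi_cauchy (x y t : C) n :
  ASC_phi a b n x y q * (t ^+ n / qpoch q q n) =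
  \sum_(k < n.+1) qhyper_term a b q (x * t) k * qbin_term q (y * t) 0 (n - k).
Proof.
rewrite /ASC_phi mulr_suml; apply: eq_bigr => -[k kn] _ /=.
rewrite qbin_term_euler1 /qhyper_term /qbinom.
have -> : t ^+ n = t ^+ k * t ^+ (n - k) by rewrite -exprD subnKC.
have h1 := qpoch_qq_neq0 n q1; have h2 := qpoch_qq_neq0 k q1.
have h3 := qpoch_qq_neq0 (n - k) q1; rewrite !exprMn.
by field; rewrite h1 h2 h3.
Qed.

(** The choice of exponents in psi makes the interaction term k m of
    C(k + m, 2) cancel, leaving a power of q that depends on m only. *)
Lemma psi_exponent k m : q != 0 ->
  q ^+ 'C(k + m, 2) * q ^ ('C(k.+1, 2)%:Z - ((k + m) * k)%N%:Z) = q ^+ 'C(m, 2).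
Proof.
move=> q0; rewrite expfzDr// -exprnN -exprnP mulrA -exprD.
have e : ('C(k + m, 2) + 'C(k.+1, 2) = 'C(m, 2) + (k + m) * k)%N.
  elim: k => [|k IH]; first by rewrite add0n muln0 (@bin_small 1 2).
  by move: IH; rewrite addSn !binS !bin1 !bin0; lia.
by rewrite e exprD mulfK// expf_neq0.
Qed.

Lemma ASC_psi_cauchy (x y t : C) n : q != 0 ->
  (-1) ^+ n * q ^+ 'C(n, 2) * ASC_psi a b n x y q * (t ^+ n / qpoch q q n) =
  \sum_(k < n.+1) qhyper_term a b q (x * t) k * qbin_term q 0 (y * t) (n - k).
Proof.
move=> q0; rewrite /ASC_psi mulr_sumr mulr_suml; apply: eq_bigr => -[k kn] _ /=.
rewrite qbin_term_euler2 /qhyper_term /qbinom.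
have {kn} [m ->] : exists m, n = (k + m)%N by exists (n - k)%N; rewrite subnKC.
rewrite addKn -(psi_exponent k m q0).
have h1 := qpoch_qq_neq0 (k + m) q1; have h2 := qpoch_qq_neq0 k q1.
have h3 := qpoch_qq_neq0 m q1; rewrite !exprMn !exprD.
have sgn : (-1) ^+ k * (-1) ^+ k = 1 :> C by rewrite -expr2 sqrr_sign.
set Q := q ^ _; rewrite -[RHS]mul1r -[X in _ = X * _]sgn.
(* The square of the sign (-1)^k now stands on the right, so both sides agree
   whatever the values of the two signs. *)
move: Q ((-1) ^+ k : C) ((-1) ^+ m : C) => Q s s'.
by field; rewrite h1 h2 h3.
Qed.
End GeneratingFunctions.

Theorem theorem3 (R : realType) (q : Cplx R) (hq0 : 0 < `|q|) (hq1 : `|q| < 1)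
    (r : nat) (a : 'I_r.+1 -> Cplx R) (b : 'I_r -> Cplx R)
    (hb : forall (j : 'I_r) (n : nat), qpoch (b j) q n != 0)
    (x y t : Cplx R) :
  (Num.max `|x * t| `|y * t| < 1 ->
    [/\ cvgn (qpoch (y * t) q), qpoch_inf (y * t) q != 0,
        cvgn (series (qhyper_term a b q (x * t))) &
        series (fun n => ASC_phi a b n x y q * (t ^+ n / qpoch q q n)) @ \oo
          --> (qpoch_inf (y * t) q)^-1 * qhyper a b q (x * t)]) /\
  (`|x * t| < 1 ->
    [/\ cvgn (qpoch (y * t) q),
        cvgn (series (qhyper_term a b q (x * t))) &
        series (fun n => (-1) ^+ n * q ^+ 'C(n, 2) * ASC_psi a b n x y q *
                         (t ^+ n / qpoch q q n)) @ \oo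
          --> qpoch_inf (y * t) q * qhyper a b q (x * t)]).
Proof.
have q0 : q != 0 by rewrite -normr_gt0.
split=> [|xt1].
  rewrite comparable_gt_max ?real_comparable ?normr_real// => /andP[xt1 yt1].
  have E := qpoch_inf_euler1 hq1 yt1.
  have P0 : qpoch_inf (y * t) q != 0.
    by apply: contra_eq_neq E => ->; rewrite mulr0 eq_sym oner_neq0.
  split=> //.
  - by apply: cvgP; exact: cvg_qpoch.
  - by apply: geom_bounded_cvg; exact: qhyper_term_bounded.
  under eq_fun do rewrite ASC_phi_cauchy//.
  have -> : (qpoch_inf (y * t) q)^-1 = qbin_sum q (y * t) 0.
    by rewrite -[RHS](mulfK P0) E mul1r.
  rewrite mulrC; apply: cauchy_product.
    exact: qhyper_term_bounded.
  exact: qbin_term_bounded.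
split.
- by apply: cvgP; exact: cvg_qpoch.
- by apply: geom_bounded_cvg; exact: qhyper_term_bounded.
under eq_fun do rewrite ASC_psi_cauchy//.
rewrite qpoch_infE// mulrC; apply: cauchy_product.
  exact: qhyper_term_bounded.
by apply: qbin_term_bounded; rewrite // normr0.
Qed.
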